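(* Let $b\ge 2$ be an integer. If $b$ is odd and the $2$-adic valuation of $b-1$ is even, then there are no strict pandigital squares in base $b$ and no strict penholodigital squares in base $b$; that is, for no integer $n$ is $n^2$ a strict pandigital or strict penholodigital number in base $b$.
   Context: The $2$-adic valuation of a positive integer $N$ is the largest integer $e$ such that $2^e$ divides $N$. Numbers are written in base $b$ without leading zeros, with digits $0,1,\dots,b-1$. A positive integer $N$ is a strict pandigital number in base $b$ if its base-$b$ representation contains each of the $b$ digits $0,1,\dots,b-1$ exactly once. $N$ is a strict penholodigital number in base $b$ if its base-$b$ representation does not contain the digit $0$ and contains each of the $b-1$ nonzero digits $1,\dots,b-1$ exactly once. *)

(* Defs.v *)
From mathcomp Require Import all_boot.

Set Implicit Arguments.
Unset Strict Implicit.
Unset Printing Implicit Defensive.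

(* Least significant digit first. For b > 1 and N > 0, the length is the
   number of base-b digits of N, since b ^ trunc_log b N <= N and
   N < b ^ (trunc_log b N).+1; see digitsP. *)
Definition digits (b N : nat) : seq nat :=
  mkseq (fun i => N %/ b ^ i %% b) (trunc_log b N).+1.

Definition strict_pandigital (b N : nat) : Prop :=
  0 < N /\ forall d, d < b -> count_mem d (digits b N) = 1.

Definition strict_penholodigital (b N : nat) : Prop :=
  [/\ 0 < N, 0 \notin digits b N &
      forall d, 0 < d < b -> count_mem d (digits b N) = 1].

Lemma digitsP (b N : nat) : 1 < b -> 0 < N ->
  [/\ all (fun d => d < b) (digits b N), last 0 (digits b N) != 0 &
      N = \sum_(i < size (digits b N)) nth 0 (digits b N) i * b ^ i].
Proof.
move=> b1 N0; have b0 : 0 < b by apply: ltnW.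
have /andP[leN ltN] := trunc_log_bounds b1 N0.
split.
- by apply/allP=> d /mapP[i _ ->]; rewrite ltn_pmod.
- rewrite -nth_last size_mkseq nth_mkseq //= modn_small.
    by rewrite -lt0n divn_gt0 ?expn_gt0 ?b0.
  by rewrite ltn_divLR ?expn_gt0 ?b0 // -expnS.
- have sumE k : N %% b ^ k = \sum_(i < k) N %/ b ^ i %% b * b ^ i.
    elim: k => [|k IHk]; first by rewrite big_ord0 modn1.
    rewrite big_ord_recr /= -IHk modn_divl -expnS addnC.
    rewrite [LHS](divn_eq _ (b ^ k)) modn_dvdm //.
    by rewrite dvdn_exp2l.
  rewrite size_mkseq -[LHS](modn_small ltN) sumE.
  by apply: eq_bigr => i _; rewrite nth_mkseq.
Qed.

(* Main.v *)
Require Import Defs.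
From mathcomp Require Import all_boot all_order all_algebra.
Import GRing.Theory.

(** Modulo [b - 1], a number is congruent to its digit sum, which is
    [b (b - 1) / 2] in both cases. For [b = 2 c + 1] this makes [N] congruent to
    [c] modulo [2 c], so [N] is an odd multiple of [c]; if the 2-adic valuation
    of [2 c] is even, then that of [N] is odd and [N] is not a square. *)

Lemma sum_seq_count {b : nat} {s : seq nat} : all (fun d => d < b) s ->
  \sum_(x <- s) x = \sum_(d < b) count_mem (val d) s * d.
Proof.
elim: s => [|x s IHs] /=; first by rewrite big_nil big1.
case/andP=> xb /IHs IH; rewrite big_cons IH.
under [RHS]eq_bigr do rewrite mulnDl.
rewrite big_split /=; congr (_ + _).
rewrite (bigD1 (Ordinal xb)) //= eqxx mul1n big1 ?addn0 // => i.
by rewrite -val_eqE /= eq_sym => /negPf->.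
Qed.

Lemma sum_digits_modn_pred {b N : nat} : 1 < b -> 0 < N ->
  N = \sum_(x <- digits b N) x %[mod b.-1].
Proof.
move=> b1 N0; have [_ _ {1}->] := digitsP b1 N0.
rewrite (big_nth 0) big_mkord.
elim/big_ind2: _ => // [x1 x2 y1 y2 Ex Ey|i _]; first by rewrite -modnDm Ex Ey modnDm.
have b_mod : b = 1 %[mod b.-1] by rewrite -{1}(ltn_predK b1) -addn1 modnDl.
by rewrite -modnMmr -modnXm b_mod modnXm exp1n modnMmr muln1.
Qed.

(** The digit 0 adds nothing to the digit sum, so its number of occurrences is left free; this lets
    one hypothesis serve both the pandigital and the penholodigital case. *)
Lemma modn_nonzero_digits_once {c N : nat} : 0 < c -> 0 < N ->
    (forall d, 0 < d < c.*2.+1 -> count_mem d (digits c.*2.+1 N) = 1) ->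
  N %% c.*2 = c.
Proof.
move=> c0 N0 once; have b1 : 1 < c.*2.+1 by rewrite ltnS double_gt0.
have [digits_lt _ _] := digitsP b1 N0.
rewrite (sum_digits_modn_pred b1 N0) (sum_seq_count digits_lt) /=.
under eq_bigr => d _.
  have -> : count_mem (val d) (digits c.*2.+1 N) * d = d.
    have [->|d0] := posnP d; first by rewrite muln0.
    by rewrite once ?mul1n ?d0 /=.
  over.
(* The digits [0, ..., 2c] sum to [c (2c + 1) = c + (2c) c], which leaves [c] modulo [2c]. *)
rewrite -(big_mkord xpredT id) bin2_sum bin2 /= mulnC -doubleMl doubleK.
rewrite mulnS -doubleMr doubleMl mulnC addnC modnMDl.
by rewrite modn_small // -addnn -{1}[c]addn0 ltn_add2l.
Qed.

Lemma logn2_nonzero_digits_once {b N : nat} : 1 < b -> odd b -> 0 < N ->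
    (forall d, 0 < d < b -> count_mem d (digits b N) = 1) ->
  logn 2 (b - 1) = (logn 2 N).+1.
Proof.
move=> b1 bodd N0 once; set c := b./2.
have bE : b = c.*2.+1 by rewrite -[LHS]odd_double_half bodd.
have c0 : 0 < c by move: b1; rewrite bE ltnS double_gt0.
rewrite bE in once; have Nc := modn_nonzero_digits_once c0 N0 once.
(* With quotient [q] and remainder [c] in the division by [2c], [N = (2q + 1) c]. The odd factor has
   valuation 0, so [N] has the valuation of [c], one less than that of [2c]. *)
have -> : N = (N %/ c.*2).*2.+1 * c.
  by rewrite {1}(divn_eq N c.*2) Nc mulSn addnC -doubleMl -doubleMr.
rewrite bE subn1 /= -mul2n !lognM // [logn 2 _.*2.+1]lognE.
by rewrite dvdn2 /= odd_double.
Qed.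

Theorem corollary1 (b : nat) :
  2 <= b -> odd b -> ~~ odd (logn 2 (b - 1)) ->
  forall (n : int) (N : nat), (n ^+ 2)%R = N%:Z%R ->
    ~ strict_pandigital b N /\ ~ strict_penholodigital b N.
Proof.
move=> b1 bodd vb n N n2N.
have NE : N = `|n|%N ^ 2 by rewrite -abszX n2N.
have no_sq : 0 < N ->
    ~ (forall d, 0 < d < b -> count_mem d (digits b N) = 1).
  move=> N0 /(logn2_nonzero_digits_once b1 bodd N0) vN.
  (* The valuation of [b - 1] would be [2k + 1], with [k] the valuation of the absolute value of
     [n], against its evenness. *)
  by move: vb; rewrite vN NE lognX mul2n /= odd_double.
split=> [[N0 once]|[N0 _ once]]; apply: (no_sq N0) => // d /andP[_].
exact: once.
Qed.
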